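(* Suppose that $R(\mathfrak m)\cap\tilde{\mathfrak m}\neq\emptyset$ and choose an arbitrary point $x_0\in R(\mathfrak m)\cap R(\tilde{\mathfrak m})$. Let $\mathfrak k^{x_0}=\mathfrak z(\mathfrak g)$. Then the set $Q_a(\mathfrak m)\cap\tilde{\mathfrak m}$ is nonempty if and only if the subspace $\mathfrak k'=(1-\sigma)\mathfrak k$ contains regular elements of the Lie algebra $\mathfrak k$.
   Context: Let $G$ be a compact connected Lie group with Lie algebra $\mathfrak g$, and let $\langle\cdot,\cdot\rangle=-\Phi_\chi$, where $\chi$ is a faithful representation of $\mathfrak g$ whose associated bilinear (trace) form $\Phi_\chi$ is negative definite on $\mathfrak g$; $\langle\cdot,\cdot\rangle$ is an invariant scalar product on $\mathfrak g$. Let $\sigma$ be an involutive automorphism of $\mathfrak g$, and assume $\langle\cdot,\cdot\rangle$ is $\sigma$-invariant. Let $\mathfrak g=\tilde{\mathfrak g}\oplus\mathfrak g'$ be the decomposition into the $+1$ and $-1$ eigenspaces of $\sigma$. Fix $a\in\mathfrak g'$, put $\mathfrak k=\mathfrak g^a$ (for $x\in\mathfrak g$, $\mathfrak g^x$ denotes the centralizer of $x$ in $\mathfrak g$) and $\mathfrak m=\mathfrak k^\perp$ in $\mathfrak g$. These spaces are $\sigma$-invariant; put $\tilde{\mathfrak k}=\mathfrak k\cap\tilde{\mathfrak g}$, $\mathfrak k'=\mathfrak k\cap\mathfrak g'=(1-\sigma)\mathfrak k$, $\tilde{\mathfrak m}=\mathfrak m\cap\tilde{\mathfrak g}$, so $\tilde{\mathfrak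 g}=\tilde{\mathfrak k}\oplus\tilde{\mathfrak m}$. The operator $\operatorname{ad}a|_{\mathfrak m}:\mathfrak m\to\mathfrak m$ is invertible; $\operatorname{ad}_a^{-1}$ denotes its inverse. $\mathfrak z(\mathfrak g)$ is the center of $\mathfrak g$. For $x\in\mathfrak m$ put $\mathfrak k^x=\mathfrak g^x\cap\mathfrak k$ and $\mathfrak m(x)=\{y\in\mathfrak m:[x,y]\in\mathfrak m\}$. Let $q(\mathfrak m)=\min_{y\in\mathfrak m}\dim\mathfrak g^y$, $p(\mathfrak m)=\min_{y\in\mathfrak m}\dim\mathfrak k^y$, $r(\mathfrak m)=q(\mathfrak m)-p(\mathfrak m)$ and $R(\mathfrak m)=\{x\in\mathfrak m:\dim\mathfrak g^x=q(\mathfrak m),\ \dim\mathfrak k^x=p(\mathfrak m)\}$. The set $R(\tilde{\mathfrak m})\subset\tilde{\mathfrak m}$ is defined in the same way for the pair $(\tilde{\mathfrak g},\tilde{\mathfrak k})$ (minimizing $\dim\tilde{\mathfrak g}^y$ and $\dim\tilde{\mathfrak k}^y$ over $y\in\tilde{\mathfrak m}$). Finally $$Q_a(\mathfrak m)=\{x\in R(\mathfrak m):\dim\big(\mathfrak m(x)\cap\operatorname{ad}_a^{-1}(\operatorname{ad}x(\mathfrak k))\big)=r(\mathfrak m)\}.$$ An element of a compact Lie algebra is regular if the dimension of its centralizer in that algebra equals the rank of the algebra. *)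

(* Defs.v *)
From HB Require Import structures.
From mathcomp Require Import all_boot all_order all_algebra.
From mathcomp Require Import boolp classical_sets reals.

Set Implicit Arguments.
Unset Strict Implicit.
Unset Printing Implicit Defensive.

Import Order.TTheory GRing.Theory Num.Theory.
Local Open Scope ring_scope.

HB.mixin Record Vector_isLieAlgebra (R : fieldType) (L : Type)
    of Vector R L := {
  lie : L -> L -> L;
  lie_linearl : forall (c : R) (x y z : L),
    lie (c *: x + y) z = c *: lie x z + lie y z;
  lie_linearr : forall (c : R) (x y z : L),
    lie x (c *: y + z) = c *: lie x y + lie x z;
  liexx : forall x : L, lie x x = 0;
  lie_jacobi : forall x y z : L,
    lie x (lie y z) + lie y (lie z x) + lie z (lie x y) = 0
}.

#[short(type="lieAlgType")]
HB.structure Definition LieAlgebra (R : fieldType) :=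
  {L of Vector_isLieAlgebra R L & Vector R L}.

Section LieAlgebra.
Variables (R : fieldType) (g : lieAlgType R).

HB.instance Definition _ (x : g) :=
  GRing.isLinear.Build R g g *:%R (lie x) (fun c => @lie_linearr R g c x).

Definition ad (x : g) : 'End(g) := linfun (lie x).

Lemma adE (x y : g) : ad x y = lie x y.
Proof. by rewrite lfunE. Qed.

Fact ad_is_linear : linear ad.
Proof.
move=> c x y; apply/lfunP => z.
by rewrite add_lfunE scale_lfunE !adE lie_linearl.
Qed.

HB.instance Definition _ :=
  GRing.isLinear.Build R g 'End(g) *:%R ad ad_is_linear.

Definition lie_center : {vspace g} := lker (linfun ad).

Lemma lie_centerP (x : g) :
  reflect (forall y, lie x y = 0) (x \in lie_center).
Proof.
rewrite memv_ker lfunE; apply: (iffP eqP) => [ad0 y | lie0].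
  by rewrite -adE ad0 zero_lfunE.
by apply/lfunP => y; rewrite adE lie0 zero_lfunE.
Qed.

Definition centralizer (U : {vspace g}) (x : g) : {vspace g} :=
  (U :&: lker (ad x))%VS.

Lemma centralizerP (U : {vspace g}) (x y : g) :
  (y \in centralizer U x) = (y \in U) && (lie x y == 0).
Proof. by rewrite memv_cap memv_ker adE. Qed.

Definition lie_abelian (T : {vspace g}) : Prop :=
  forall x y, x \in T -> y \in T -> lie x y = 0.

Fact lie_rank_ex (U : {vspace g}) : exists d : nat,
  `[< exists T : {vspace g}, [/\ (T <= U)%VS, lie_abelian T & \dim T = d] >].
Proof.
exists 0%N; apply/asboolP; exists 0%VS; split; rewrite ?sub0v ?dimv0 //.
by move=> x y; rewrite memv0 => /eqP-> _; rewrite -adE linear0 zero_lfunE.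
Qed.

Fact lie_rank_bound (U : {vspace g}) (d : nat) :
  `[< exists T : {vspace g}, [/\ (T <= U)%VS, lie_abelian T & \dim T = d] >] ->
  (d <= \dim U)%N.
Proof. by move/asboolP => [T [sTU _ <-]]; exact: dimvS. Qed.

(* The rank of a compact Lie algebra [U] is the dimension of its Cartan
   subalgebras, that is, of its maximal abelian subalgebras; these are all
   conjugate, hence the maximum over all abelian subalgebras. *)
Definition lie_rank (U : {vspace g}) : nat :=
  ex_maxn (lie_rank_ex U) (@lie_rank_bound U).

Definition regular_in (U : {vspace g}) (x : g) : Prop :=
  x \in U /\ \dim (centralizer U x) = lie_rank U.

Fact min_dim_ex (M : {vspace g}) (F : g -> {vspace g}) :
  exists d : nat, `[< exists2 y, y \in M & \dim (F y) = d >].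
Proof.
by exists (\dim (F 0)); apply/asboolP; exists 0; rewrite ?mem0v.
Qed.

Definition min_dim (M : {vspace g}) (F : g -> {vspace g}) : nat :=
  ex_minn (min_dim_ex M F).

(* In the next definitions [G] is the ambient algebra, [K] a subalgebra of [G]
   and [M] the orthogonal complement of [K] in [G]. *)

Definition qdim (G M : {vspace g}) : nat := min_dim M (centralizer G).

Definition pdim (K M : {vspace g}) : nat := min_dim M (centralizer K).

(* [pdim K M <= qdim G M] as [K] is contained in [G], so that the subtraction
   is never truncated. *)
Definition rdim (G K M : {vspace g}) : nat := (qdim G M - pdim K M)%N.

Definition Rset (G K M : {vspace g}) : set g :=
  [set x | [/\ x \in M, \dim (centralizer G x) = qdim G M
             & \dim (centralizer K x) = pdim K M]].

Definition mspace (M : {vspace g}) (x : g) : {vspace g} :=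
  (M :&: ad x @^-1: M)%VS.

(* For [ad a] invertible on [M] and [S] contained in [M], this is the image of
   [S] under the inverse of the restriction of [ad a] to [M]. *)
Definition ad_inv (M : {vspace g}) (a : g) (S : {vspace g}) : {vspace g} :=
  (M :&: ad a @^-1: S)%VS.

Definition Qset (a : g) (G K M : {vspace g}) : set g :=
  [set x | Rset G K M x /\
    \dim (mspace M x :&: ad_inv M a (ad x @: K)) = rdim G K M].

Definition lie_automorphism (s : 'End(g)) : Prop :=
  bijective s /\ forall x y, s (lie x y) = lie (s x) (s y).

Definition plus_space (s : 'End(g)) : {vspace g} := lker (s - \1)%VF.

Definition minus_space (s : 'End(g)) : {vspace g} := lker (s + \1)%VF.

(* A real Lie algebra with a faithful representation whose trace form is
   negative definite is compact, i.e., is the Lie algebra of a compact connected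
   Lie group; the group itself is therefore not part of the data. *)
Definition is_representation n (chi : g -> 'M[R]_n) : Prop :=
  forall x y, chi (lie x y) = chi x *m chi y - chi y *m chi x.

Definition trace_form n (chi : g -> 'M[R]_n) (x y : g) : R :=
  \tr (chi x *m chi y).

Definition scalar_product n (chi : g -> 'M[R]_n) (x y : g) : R :=
  - trace_form chi x y.

End LieAlgebra.

Section Orthogonal.
Variables (R : fieldType) (g : lieAlgType R) (n : nat).
Variable chi : {linear g -> 'M[R]_n}.

Definition pairing_row (U : {vspace g}) (y : g) : 'rV[R]_(\dim U) :=
  \row_i scalar_product chi (vbasis U)`_i y.

Fact pairing_row_is_linear (U : {vspace g}) : linear (pairing_row U).
Proof.
move=> c x y; apply/rowP => i; rewrite !mxE /scalar_product /trace_form.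
by rewrite linearP /= mulmxDr -scalemxAr mxtraceD mxtraceZ opprD mulrN.
Qed.

HB.instance Definition _ (U : {vspace g}) :=
  GRing.isLinear.Build R g 'rV[R]_(\dim U) *:%R (pairing_row U)
    (pairing_row_is_linear U).

Definition ortho_compl (U : {vspace g}) : {vspace g} :=
  lker (linfun (pairing_row U)).

Lemma ortho_complP (U : {vspace g}) (y : g) :
  reflect (forall x, x \in U -> scalar_product chi x y = 0)
          (y \in ortho_compl U).
Proof.
rewrite memv_ker lfunE /=; apply: (iffP eqP) => [/rowP orthU x xU | orthU].
  rewrite (coord_vbasis xU) /scalar_product /trace_form linear_sum mulmx_suml.
  rewrite (raddf_sum (@mxtrace R n)) big1 ?oppr0 // => i _.
  rewrite linearZ /= -scalemxAl mxtraceZ.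
  move: (orthU i); rewrite !mxE => /eqP; rewrite oppr_eq0.
  by rewrite /trace_form => /eqP->; rewrite mulr0.
apply/rowP => i; rewrite !mxE orthU //.
by rewrite vbasis_mem // mem_nth ?size_tuple.
Qed.

End Orthogonal.

Lemma one_sub_sigmaE (R : realType) (g : lieAlgType R) (s : 'End(g)) (a : g) :
  lie_automorphism s -> involutive s -> a \in minus_space s ->
  ((\1 - s)%VF @: centralizer fullv a =
     centralizer fullv a :&: minus_space s)%VS.
Proof.
move=> [_ sM] sK; rewrite memv_ker add_lfunE id_lfunE addr_eq0 => /eqP sa.
have sk x : x \in centralizer fullv a -> s x \in centralizer fullv a.
  rewrite !centralizerP !memvf /= => /eqP ax0.
  have : s (lie a x) = 0 by rewrite ax0 linear0.
  by rewrite sM sa -!adE linearN opp_lfunE /= => /eqP; rewrite oppr_eq0.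
apply/vspaceP => y; apply/idP/idP.
  case/memv_imgP => x xk ->; rewrite memv_cap memv_ker !add_lfunE !opp_lfunE.
  rewrite !id_lfunE rpredB ?sk //= raddfB /= sK addrA subrK subrr //.
rewrite memv_cap memv_ker add_lfunE id_lfunE addr_eq0 => /andP[yk /eqP sy].
have -> : y = (\1 - s)%VF (2^-1 *: y).
  rewrite !add_lfunE opp_lfunE id_lfunE linearZ /= sy scalerN opprK -scalerDl.
  by rewrite -[2^-1]div1r -splitr scale1r.
by rewrite memv_img // memvZ.
Qed.

(* Main.v *)
Require Import Defs.
From HB Require Import structures.
From mathcomp Require Import all_boot all_order all_algebra.
From mathcomp Require Import boolp classical_sets reals.

Set Implicit Arguments.
Unset Strict Implicit.
Unset Printing Implicit Defensive.

Import Order.TTheory GRing.Theory Num.Theory.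
Import passmx.
Local Open Scope classical_set_scope.
Local Open Scope ring_scope.

(** Write k for the centralizer of a, m for its orthogonal complement, and J for
    the inverse of ad a on m. Everything is governed by the quadratic map
    xi : m -> k, where xi(x) is the component in k of [x, J x] ([moment] below).

    For x in m the map c |-> [J x, c] carries the centralizer of xi(x) in k onto
    the space m(x) :&: ad_a^-1 [x, k], with kernel the centralizer of x in k: by
    invariance of the form and the Jacobi identity, for y and z in k the number
    <[xi(x), y], z> is twice <[x, [J x, y]], z>, so that [x, [J x, y]] lies in m
    exactly when [xi(x), y] = 0 ([moment_form], [Qspace_image]). Hence a point x
    of R(m) belongs to Q_a(m) if and only if the centralizer of xi(x) in k has
    dimension q(m).

    Next, q(m) is the rank of k. If a pencil x + t u never has a smaller
    centralizer than x has, then u is orthogonal to every bracket of two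
    elements centralizing x ([first_order]). As x0 has the smallest centralizer
    on all of m, the brackets of its centralizer lie in the orthogonal
    complement of m, that is in k, hence in the centralizer of x0 in k, which is
    the center; being also orthogonal to the center, they vanish. So the
    centralizer of x0 is abelian. It remains to know that in a compact algebra
    an abelian subspace is never larger than the centralizer of any element
    ([abelian_dim_le_centralizer]). This is the substitute for the conjugacy of
    Cartan subalgebras, and it is proved with formal power series: if the
    centralizer A of h is abelian, then every pencil h + t u is the image of a
    formal curve of A under a formal one-parameter family of automorphisms, and
    the image of A under this family centralizes the pencil. In particular no
    element of k has a centralizer in k of dimension smaller than q(m) = rank k
    ([regular_in_m]).

    When x is fixed by sigma, J x and therefore xi(x) are changed into their
    opposites, so xi maps the fixed part of m into k'. This gives the direct
    implication: for x in Q_a(m) fixed by sigma, xi(x) is regular and lies in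
    k'.

    Conversely, the differential of xi at x0, restricted to the fixed part of m,
    covers k' modulo the centralizer of x0 in k, that is modulo the center
    ([moment_submersion]). If k' contains a regular element y, regularity is a
    nonzero polynomial condition on k', and a quadratic map which is a
    submersion at one point cannot send a whole space into the zeros of a
    nonzero polynomial: one compares the lowest order terms along a suitable
    curve xi(x0 + t v) ([det_quadratic_curve]). For generic t the point x0 + t v
    stays in R(m) by semicontinuity of the rank, and has a regular image. *)

(** * Determinants along polynomial curves of endomorphisms *)

Section PolyFacts.
Variable F : numFieldType.

Lemma poly0_horner (p : {poly F}) : (forall t, p.[t] = 0) -> p = 0.
Proof.
move=> p0; apply/eqP; apply/negPn/negP => pn0.
pose s := [seq (i%:R : F) | i <- iota 0 (size p)].
have us : uniq s.
  rewrite map_inj_uniq ?iota_uniq // => i j /eqP.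
  by rewrite eqr_nat => /eqP.
have rs : all (root p) s by apply/allP => x _; rewrite /root p0.
by have := max_poly_roots pn0 rs us; rewrite size_map size_iota ltnn.
Qed.

Lemma poly_neq0_horner (p : {poly F}) : p != 0 -> exists t, p.[t] != 0.
Proof.
move=> pn0; apply: contrapT => np; case/negP: pn0; apply/eqP/poly0_horner => t.
by apply/eqP/negPn/negP => pt; apply: np; exists t.
Qed.

(** Seen as a polynomial in c, the determinant of T + c E differs from its value
    at c = 0 by a multiple of c. *)
Lemma det_perturb_dvd m (T E : 'M[{poly F}]_m) (c : {poly F}) :
  c %| \det (T + c *: E) - \det T.
Proof.
pose P : {poly {poly F}} := \det (map_mx polyC T + 'X *: map_mx polyC E).
have Pe x : P.[x] = \det (T + x *: E).
  rewrite /P -horner_evalE -det_map_mx; congr (\det _).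
  apply/matrixP => i j; rewrite !mxE /horner_eval.
  by rewrite -[LHS]/((_ + _).[x]) hornerD hornerM hornerX !hornerC.
have -> : \det T = P.[0] by rewrite Pe scale0r addr0.
rewrite -Pe.
have : root (P - (P.[0])%:P) 0 by rewrite /root hornerD hornerN hornerC subrr.
case/factor_theorem => q /(congr1 (fun p => p.[c])).
rewrite hornerM !hornerD !hornerN hornerX !hornerC subr0 => ->.
exact: dvdp_mull.
Qed.

Lemma poly_Xn_dvd0 (p : {poly F}) : (forall n, 'X^n %| p) -> p = 0.
Proof.
move=> dvd; apply/eqP/negPn/negP => pn0.
by have := dvdp_leq pn0 (dvd (size p)); rewrite size_polyXn ltnn.
Qed.

End PolyFacts.

Section EndDet.
Variables (F : numFieldType) (V : vectType F).
Implicit Types (f h : 'End(V)) (U W : {vspace V}).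

Let e := vbasis {:V}.
Let e_basis : basis_of {:V} e := vbasisP _.
Let e_free : free e := basis_free e_basis.

Definition lfun_det f : F := \det (mxof e e f).

Lemma lfun_detM f h : lfun_det (f \o h)%VF = lfun_det f * lfun_det h.
Proof. by rewrite /lfun_det (mxof_comp e e e_basis) det_mulmx mulrC. Qed.

Lemma lfun_det1 : lfun_det \1%VF = 1.
Proof. by rewrite /lfun_det mxof1 // det1. Qed.

Lemma lfun_det_neq0 f : (lfun_det f != 0) = (lker f == 0%VS).
Proof.
apply/idP/idP => [fn0 | /lker0_compfV fV]; last first.
  apply/eqP => f0; have := lfun_detM f f^-1.
  by rewrite fV lfun_det1 f0 mul0r => /eqP; rewrite oner_eq0.
rewrite -subv0; apply/subvP => v; rewrite memv_ker => /eqP fv.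
have := rVof_app e e_basis f v; rewrite fv linear0.
have Mu : mxof e e f \in unitmx by rewrite unitmxE unitfE.
move/(congr1 (fun x => x *m invmx (mxof e e f))).
rewrite mulmxK // mul0mx => v0.
by rewrite -(rVofK e_basis v) -v0 linear0 mem0v.
Qed.

Definition mxcurve (C : nat -> 'End(V)) m : 'M[{poly F}]_(\dim {:V}) :=
  \sum_(j < m) 'X^j *: map_mx polyC (mxof e e (C j)).

Definition det_curve (C : nat -> 'End(V)) m : {poly F} := \det (mxcurve C m).

Lemma mxcurveE C m t :
  map_mx (horner_eval t) (mxcurve C m) = mxof e e (\sum_(j < m) t ^+ j *: C j).
Proof.
apply/matrixP => i k; rewrite [in RHS]linear_sum !mxE /horner_eval !summxE.
rewrite horner_sum; apply: eq_bigr => j _.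
by rewrite linearZ !mxE hornerM hornerXn hornerC.
Qed.

Lemma det_curveE C m t :
  (det_curve C m).[t] = lfun_det (\sum_(j < m) t ^+ j *: C j).
Proof. by rewrite -[LHS]/(horner_eval t _) -det_map_mx mxcurveE. Qed.

End EndDet.

(** * Semicontinuity of the rank *)

Section Rank.
Variables (F : numFieldType) (V : vectType F).
Implicit Types (f h : 'End(V)) (U : {vspace V}).

(** On the image of f this is h composed with a section of f. It is the identity
    when h = f and depends affinely on h, so that its determinant is a
    polynomial certificate for the rank of h being at least that of f. *)
Definition rank_test f h : 'End(V) := (\1 - (f \o f^-1) + (h \o f^-1))%VF.

Lemma rank_test_id f : rank_test f f = \1%VF.
Proof. by rewrite /rank_test subrK. Qed.

Lemma rank_test_dim f h :
  lfun_det (rank_test f h) != 0 -> (\dim (limg f) <= \dim (limg h))%N.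
Proof.
rewrite lfun_det_neq0 => /eqP k0.
rewrite -(@limg_dim_eq _ _ _ (rank_test f h) (limg f)); last first.
  by rewrite k0 capv0.
apply/dimvS/subvP => _ /memv_imgP[w wf ->].
rewrite !add_lfunE opp_lfunE !comp_lfunE id_lfunE (limg_lfunVK wf) subrr add0r.
by rewrite memv_img ?memvf.
Qed.

Lemma limg_projr f U : limg (f \o projv U)%VF = (f @: U)%VS.
Proof. by rewrite limg_comp limg_proj. Qed.

Lemma rank_lower_semicont U f h :
  exists2 P : {poly F}, P != 0 & forall t, P.[t] != 0 ->
    (\dim (f @: U) <= \dim ((f + t *: h)%R @: U))%N.
Proof.
pose fU := (f \o projv U)%VF.
pose D j : 'End(V) := if j is 0%N then \1%VF else (h \o projv U \o fU^-1)%VF.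
have DE t : \sum_(j < 2) t ^+ j *: D j =
    rank_test fU ((f + t *: h)%R \o projv U)%VF.
  rewrite !big_ord_recl big_ord0 /= addr0 expr0 expr1 scale1r.
  rewrite /rank_test comp_lfunDl comp_lfunDl addrA subrK; congr (_ + _).
  by rewrite -!comp_lfunZl.
exists (det_curve D 2) => [|t].
  apply/eqP => /(congr1 (fun p => p.[0])); rewrite det_curveE DE scale0r addr0.
  by rewrite rank_test_id lfun_det1 horner0 => /eqP; rewrite oner_eq0.
by rewrite det_curveE DE => /rank_test_dim; rewrite !limg_projr.
Qed.

End Rank.

(** * Brackets and centralizers *)

Section LieFacts.
Variables (R : fieldType) (g : lieAlgType R).
Implicit Types (x y z : g) (U : {vspace g}).

Lemma lieDl x y z : lie (x + y) z = lie x z + lie y z.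
Proof. by have := lie_linearl 1 x y z; rewrite !scale1r. Qed.

Lemma lie0l z : lie 0 z = 0.
Proof. by rewrite -adE linear0 zero_lfunE. Qed.

Lemma lieZl c x z : lie (c *: x) z = c *: lie x z.
Proof. by have := lie_linearl c x 0 z; rewrite lie0l !addr0. Qed.

Lemma lieNl x z : lie (- x) z = - lie x z.
Proof. by rewrite -!scaleN1r lieZl. Qed.

Lemma lieC x y : lie x y = - lie y x.
Proof.
apply/eqP; rewrite -addr_eq0; have := liexx (x + y).
by rewrite lieDl !linearD /= !liexx addr0 add0r => ->.
Qed.

Lemma lie_leibniz x y z : lie x (lie y z) = lie (lie x y) z + lie y (lie x z).
Proof.
have := lie_jacobi x y z; rewrite (lieC z (lie x y)) (lieC z x) linearN /=.
by move/eqP; rewrite subr_eq0 => /eqP <-; rewrite addrNK.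
Qed.

Lemma centralizer_dim U x :
  (\dim (centralizer U x) + \dim (ad x @: U))%N = \dim U.
Proof. exact: limg_ker_dim. Qed.

Lemma leq_centralizer_dim U x y :
  (\dim (centralizer U x) <= \dim (centralizer U y))%N =
  (\dim (ad y @: U) <= \dim (ad x @: U))%N.
Proof.
rewrite -(leq_add2r (\dim (ad x @: U))) centralizer_dim.
by rewrite -(centralizer_dim U y) leq_add2l.
Qed.

End LieFacts.

(** * The invariant scalar product *)

Section InvariantForm.
Variables (R : realType) (g : lieAlgType R) (n : nat).
Variable chi : {linear g -> 'M[R]_n}.
Hypothesis chi_rep : is_representation chi.
Hypothesis chi_neg : forall x : g, x != 0 -> trace_form chi x x < 0.
Implicit Types (x y z u : g) (U V : {vspace g}).

Local Notation ip := (scalar_product chi).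

Lemma ipC x y : ip x y = ip y x.
Proof. by rewrite /scalar_product /trace_form mxtrace_mulC. Qed.

Fact ip_is_linear x : linear_for *%R (ip x).
Proof.
move=> c y z; rewrite /scalar_product /trace_form.
by rewrite linearP mulmxDr -scalemxAr mxtraceD mxtraceZ opprD mulrN.
Qed.

HB.instance Definition _ x :=
  GRing.isLinear.Build R g R *%R (ip x) (ip_is_linear x).

Lemma ipDl x y z : ip (x + y) z = ip x z + ip y z.
Proof. by rewrite ipC linearD /= !(ipC z). Qed.

Lemma ipNl x y : ip (- x) y = - ip x y.
Proof. by rewrite ipC linearN /= ipC. Qed.

(** The cyclicity of the trace, applied to commutators of matrices. *)
Lemma ip_invariant x y z : ip (lie x y) z = ip x (lie y z).
Proof.
rewrite /scalar_product /trace_form !chi_rep mulmxBl mulmxBr !linearB /=.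
by rewrite !mulmxA -(mulmxA (chi y)) (mxtrace_mulC (chi y)).
Qed.

Lemma ip_skew x y z : ip (lie x y) z = - ip y (lie x z).
Proof. by rewrite lieC ipNl ip_invariant. Qed.

Lemma ip_eq0 x : ip x x = 0 -> x = 0.
Proof.
move=> x0; apply/eqP/negPn/negP => /chi_neg.
rewrite lt_neqAle => /andP[/eqP + _].
by apply; apply/eqP; rewrite -oppr_eq0; apply/eqP.
Qed.

Lemma ortho_cap U : (U :&: ortho_compl chi U = 0)%VS.
Proof.
apply/eqP; rewrite -subv0; apply/subvP => x; rewrite memv_cap => /andP[xU].
by move/ortho_complP => /(_ _ xU) /ip_eq0 ->; rewrite mem0v.
Qed.

Lemma ortho_sum U : (U + ortho_compl chi U)%VS = fullv.
Proof.
apply/eqP; rewrite eqEdim subvf dimv_disjoint_sum ?ortho_cap //=.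
have := limg_ker_dim (linfun (pairing_row chi U)) fullv; rewrite capfv => <-.
rewrite addnC leq_add2r (leq_trans (dimvS (subvf _))) //.
by rewrite dimvf /dim /= mul1n.
Qed.

Definition oproj U : 'End(g) := daddv_pi U (ortho_compl chi U).

Lemma oproj_in U x : oproj U x \in U.
Proof. exact: memv_pi. Qed.

Lemma oproj_id U x : x \in U -> oproj U x = x.
Proof. by apply: daddv_pi_id; exact: ortho_cap. Qed.

Lemma oprojC_in U x : x - oproj U x \in ortho_compl chi U.
Proof.
have /(daddv_pi_add (ortho_cap U)) {1}<- : x \in (U + ortho_compl chi U)%VS.
  by rewrite ortho_sum memvf.
by rewrite addrC addKr memv_pi.
Qed.

Lemma oproj_ip U x y : y \in U -> ip (oproj U x) y = ip x y.
Proof.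
move=> yU; have /ortho_complP/(_ y yU) := oprojC_in U x.
by rewrite linearB /= => /eqP; rewrite subr_eq0 !(ipC y) => /eqP.
Qed.

Lemma ortho_eq U x y : x \in U -> y \in U ->
  (forall z, z \in U -> ip x z = ip y z) -> x = y.
Proof.
move=> xU yU exy; apply/eqP; rewrite -subr_eq0; apply/eqP/ip_eq0.
by rewrite ipDl ipNl exy ?rpredB // subrr.
Qed.

(** Otherwise t |-> ad (x + t u) would gain rank for small t: to the image of
    ad x, which is orthogonal to k2, the first order term adds the vector
    [u, k1], which is not. *)
Lemma first_order U x u k1 k2 :
    k1 \in centralizer U x -> k2 \in centralizer U x ->
    (forall t : R,
       (\dim (centralizer U x) <= \dim (centralizer U (x + t *: u)%R))%N) ->
  ip (lie u k1) k2 = 0.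
Proof.
rewrite !centralizerP => /andP[k1U /eqP xk1] /andP[k2U /eqP xk2] minx.
pose P := projv <[k1]>%VS.
have xP v : lie x (P v) = 0.
  by have /vlineP[c ->] := memv_proj <[k1]>%VS v; rewrite linearZ /= xk1 scaler0.
have Pk1 : P k1 = k1 by apply: projv_id; exact: memv_line.
(* For t != 0 the map f + t h has its image in that of ad (x + t u): on the line
   of k1 the vector is divided by t before applying ad (x + t u). *)
pose f : 'End(g) := (ad x + (ad u \o P))%VF.
pose h : 'End(g) := (ad u \o (\1 - P))%VF.
have [p p0 ple] := rank_lower_semicont U f h.
have [|t] := @poly_neq0_horner _ ('X * p); first by rewrite mulf_neq0 ?polyX_eq0.
rewrite hornerM hornerX mulf_eq0 negb_or => /andP[t0 /ple {}ple].
have {ple} fx : (\dim (f @: U) <= \dim (ad x @: U))%N.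
  apply: (leq_trans ple); have := minx t.
  rewrite leq_centralizer_dim; apply: leq_trans.
  apply/dimvS/subvP => _ /memv_imgP[v vU ->].
  have -> : (f + t *: h)%R v = ad (x + t *: u) (v - P v + t^-1 *: P v).
    rewrite !(add_lfunE, scale_lfunE, opp_lfunE, comp_lfunE, id_lfunE, adE).
    rewrite lieDl lieZl !linearD !linearN !linearZ /= xP scaler0 oppr0 !addr0.
    rewrite scalerA mulVf // scale1r -addrA; congr (_ + _).
    by rewrite addrC.
  rewrite memv_img // rpredD ?rpredB ?rpredZ //.
    have /vlineP[c ->] := memv_proj <[k1]>%VS v; exact: rpredZ.
  have /vlineP[c ->] := memv_proj <[k1]>%VS v; exact: rpredZ.
have sxf : (ad x @: U <= f @: U)%VS.
  apply/subvP => _ /memv_imgP[v vU ->].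
  have -> : ad x v = f (v - P v).
    rewrite !(add_lfunE, comp_lfunE, adE) !linearB /= xP subr0.
    by rewrite [P (P v)]projv_proj subrr addr0.
  rewrite memv_img // rpredB //.
  have /vlineP[c ->] := memv_proj <[k1]>%VS v; exact: rpredZ.
have /eqP fE : (ad x @: U == f @: U)%VS by rewrite eqEdim sxf.
have : lie u k1 \in (ad x @: U)%VS.
  rewrite fE; apply/memv_imgP; exists k1 => //.
  by rewrite !(add_lfunE, comp_lfunE, adE) xk1 add0r Pk1.
case/memv_imgP => v vU ->; rewrite adE ip_skew xk2.
by rewrite linear0 oppr0.
Qed.

End InvariantForm.

(** * Formal series with values in a Lie algebra *)

Section Convolution.
Variable V : nmodType.

Lemma triangle_swap n (F : nat -> nat -> nat -> V) :
  \sum_(i < n.+1) \sum_(j < (n - i).+1) F i j (n - i - j)%N =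
  \sum_(j < n.+1) \sum_(i < (n - j).+1) F i j (n - j - i)%N.
Proof.
have widen (G : nat -> V) (i : 'I_n.+1) : \sum_(j < (n - i).+1) G j =
    \sum_(j < n.+1 | (i + j <= n)%N) G j :> V.
  rewrite (big_ord_widen _ G (_ : ((n - i).+1 <= n.+1)%N)) ?ltnS ?leq_subr //.
  by apply: eq_bigl => j; rewrite ltnS leq_subRL // -ltnS.
under eq_bigr => i _ do rewrite (widen (fun j => F i j (n - i - j)%N)).
rewrite (exchange_big_dep predT) //=; apply: eq_bigr => j _.
rewrite (widen (fun i => F i j (n - j - i)%N)); apply: eq_big => [i|i _].
  by rewrite addnC.
by rewrite -!subnDA addnC.
Qed.

Lemma triangle_assoc n (F : nat -> nat -> nat -> V) :
  \sum_(k < n.+1) \sum_(i < k.+1) F i (k - i)%N (n - k)%N =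
  \sum_(i < n.+1) \sum_(j < (n - i).+1) F i j (n - i - j)%N.
Proof.
have widen (G : nat -> V) (k : 'I_n.+1) : \sum_(i < k.+1) G i =
    \sum_(i < n.+1 | (i <= k)%N) G i :> V.
  by rewrite (big_ord_widen _ G (ltn_ord k)).
under eq_bigr => k _ do rewrite (widen (fun i => F i (k - i)%N (n - k)%N)).
rewrite (exchange_big_dep predT) //=; apply: eq_bigr => i _.
rewrite -(big_mkord (fun k => (i <= k)%N) (fun k => F i (k - i)%N (n - k)%N)).
rewrite -(big_mkord predT (fun j => F i j (n - i - j)%N)).
rewrite (big_cat_nat (n := i)) //=; last by rewrite ltnW.
rewrite big_nat_cond big_pred0 ?add0r; last first.
  by move=> k; case: (ltngtP k i) => //; rewrite andbF.
rewrite -{1}[val i]add0n big_addn subSn; [|by case: (i)].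
rewrite [LHS]big_nat_cond [RHS]big_nat_cond; apply: eq_big => [k|k _].
  by rewrite leq_addl andbT.
by rewrite addnK subnDA -!subnDA addnC.
Qed.

End Convolution.

Section LieSeries.
Variables (R : numFieldType) (g : lieAlgType R).
Implicit Types (x y z : nat -> g).

(** The coefficients of the bracket of two formal series. *)
Definition conv x y n := \sum_(i < n.+1) lie (x i) (y (n - i)%N).

(** The coefficients of the derivative of a formal series. *)
Definition dseq x n : g := n.+1%:R *: x n.+1.

Lemma lie_suml I (r : seq I) (f : I -> g) (v : g) :
  lie (\sum_(i <- r) f i) v = \sum_(i <- r) lie (f i) v.
Proof.
by elim/big_rec2: _ => [|i s t _ <-]; rewrite ?lie0l ?lieDl.
Qed.

Lemma conv_leibniz x y n :
  dseq (conv x y) n = conv (dseq x) y n + conv x (dseq y) n.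
Proof.
have -> : dseq (conv x y) n =
    \sum_(i < n.+2) (i%:R *: lie (x i) (y (n.+1 - i)%N)
      + (n.+1 - i)%:R *: lie (x i) (y (n.+1 - i)%N)).
  rewrite /dseq /conv scaler_sumr; apply: eq_bigr => i _.
  by rewrite -scalerDl -natrD subnKC // -ltnS.
rewrite big_split /=; congr (_ + _).
  rewrite big_ord_recl /= scale0r add0r; apply: eq_bigr => i _.
  by rewrite /= lieZl subSS.
rewrite big_ord_recr /= subnn scale0r addr0; apply: eq_bigr => i _.
by rewrite linearZ /= /dseq subSn // -ltnS.
Qed.

Lemma conv_jacobi z x y n :
  conv z (conv x y) n = conv (conv z x) y n + conv x (conv z y) n.
Proof.
transitivity (\sum_(i < n.+1) \sum_(j < (n - i).+1)
    (lie (lie (z i) (x j)) (y (n - i - j)%N)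
     + lie (x j) (lie (z i) (y (n - i - j)%N)))).
  rewrite /conv; apply: eq_bigr => i _; rewrite linear_sum.
  by apply: eq_bigr => j _; rewrite /= lie_leibniz.
under eq_bigr => i _ do rewrite big_split.
rewrite big_split /=; congr (_ + _).
  rewrite -(triangle_assoc n (fun i j l => lie (lie (z i) (x j)) (y l))).
  by apply: eq_bigr => k _; rewrite /conv lie_suml.
rewrite (triangle_swap n (fun i j l => lie (x j) (lie (z i) (y l)))).
by apply: eq_bigr => j _; rewrite linear_sum.
Qed.

(** The equation x' = [z, x] expresses each coefficient of x by the earlier
    ones. *)
Lemma ode_unique z x : (forall n, dseq x n = conv z x n) -> x 0%N = 0 ->
  forall n, x n = 0.
Proof.
move=> ode x0; elim/ltn_ind => -[//|n] IH.
apply/eqP; have := ode n; rewrite /conv big1 => [|i _]; last first.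
  by rewrite IH ?linear0 // ltnS leq_subr.
by move/eqP; rewrite /dseq scaler_eq0 pnatr_eq0.
Qed.

End LieSeries.

Lemma course_of_values_rec (T : Type) (F : seq T -> T) :
  exists f : nat -> T, forall n, f n = F (mkseq f n).
Proof.
pose s := fix s n := if n is m.+1 then rcons (s m) (F (s m)) else [::].
exists (fun n => F (s n)) => n; congr F.
by elim: n => //= n IH; rewrite mkseqS -IH.
Qed.

(** * Formal conjugation of a pencil into an abelian centralizer *)

Section FormalConjugation.
Variables (R : numFieldType) (g : lieAlgType R) (h u : g) (A : {vspace g}).
Hypothesis A_abelian : lie_abelian A.
Hypothesis A_cent : forall x, x \in A -> lie h x = 0.
Hypothesis A_split :
  forall v, exists p : g * g, p.2 \in A /\ v = lie p.1 h + p.2.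

(* The coefficients of the pencil h + t u. *)
Let B n : g := nth 0 [:: h; u] n.

(** The series K is the flow of the time-dependent derivation ad Z, hence a
    formal family of automorphisms. The last identity is the derivative of the
    equation B = K alpha, where alpha is the series in A with alpha' = beta. In
    degree n it involves the unknowns Z n and beta n only through
    [Z n, h] + beta n, so the splitting of the space as [g, h] + A solves it. *)
Lemma formal_flow : exists (Z beta : nat -> g) (K : nat -> 'End(g)),
  [/\ K 0%N = \1%VF, (forall n, beta n \in A),
      (forall n x, dseq (fun j => K j x) n = conv Z (fun j => K j x) n) &
      (forall n, dseq B n = conv Z B n + \sum_(i < n.+1) K (n - i)%N (beta i))].
Proof.
have /choice[sp spP] := A_split.
pose z0 : g * g * 'End(g) := (0, 0, 0).
(* The list s holds the triples (Z i, beta i, K i) for i < size s. *)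
pose nextK (s : seq (g * g * 'End(g))) : 'End(g) :=
  if size s is m.+1 then m.+1%:R^-1 *: \sum_(i < m.+1)
    (ad (nth z0 s i).1.1 \o (nth z0 s (m - i)%N).2)%VF
  else \1%VF.
pose nextv (s : seq (g * g * 'End(g))) : g :=
  dseq B (size s) - \sum_(i < size s) lie (nth z0 s i).1.1 (B (size s - i)%N)
  - \sum_(i < size s)
      nth 0 (rcons (map snd s) (nextK s)) (size s - i)%N (nth z0 s i).1.2.
have [f fE] := course_of_values_rec (fun s => (sp (nextv s), nextK s)).
pose Z n := (f n).1.1; pose beta n := (f n).1.2; pose K n := (f n).2.
have KE n : K n = nextK (mkseq f n) by rewrite /K fE.
have KS n : K n.+1 = n.+1%:R^-1 *: \sum_(i < n.+1) (ad (Z i) \o K (n - i)%N)%VF.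
  rewrite KE /nextK size_mkseq; congr (_ *: _); apply: eq_bigr => i _.
  by rewrite !nth_mkseq // ltnS leq_subr.
have K0 : K 0%N = \1%VF by rewrite KE.
exists Z, beta, K; split => // [n|n x|n].
- by rewrite /beta fE; case: (spP (nextv (mkseq f n))).
- rewrite /dseq KS scale_lfunE scalerA mulfV ?pnatr_eq0 // scale1r sum_lfunE.
  by apply: eq_bigr => i _; rewrite comp_lfunE adE.
have [_] := spP (nextv (mkseq f n)).
have -> : sp (nextv (mkseq f n)) = (Z n, beta n).
  by rewrite /Z /beta fE -surjective_pairing.
rewrite /nextv size_mkseq => /eqP; rewrite subr_eq => /eqP.
move=> /(canRL (subrK _)) ->; rewrite /conv.
rewrite !big_ord_recr /= !subnn K0 id_lfunE.
have -> : \sum_(i < n) lie (nth z0 (mkseq f n) i).1.1 (B (n - i)%N) =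
    \sum_(i < n) lie (Z i) (B (n - i)%N).
  by apply: eq_bigr => i _; rewrite nth_mkseq.
have -> : \sum_(i < n) nth 0 (rcons [seq i.2 | i <- mkseq f n]
      (nextK (mkseq f n))) (n - i)%N (nth z0 (mkseq f n) i).1.2 =
    \sum_(i < n) K (n - i)%N (beta i).
  apply: eq_bigr => i _; rewrite nth_mkseq //; congr (fun_of_lfun _ _).
  have -> : [seq i.2 | i <- mkseq f n] = mkseq K n by rewrite /mkseq -map_comp.
  by rewrite -KE -mkseqS nth_mkseq // ltnS leq_subr.
by rewrite [RHS]addrACA -[LHS]addrA [LHS]addrC; congr (_ + _); exact: addrC.
Qed.

(** The image under the flow K of an element x of A commutes with h + t u.
    Indeed for y in A the series [K y, K x] solves D' = [Z, D] with initial
    value [y, x] = 0, so it vanishes; then [B, K x] solves the same equation,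
    because B' = [Z, B] + K beta, and its initial value is [h, x] = 0. *)
Lemma formal_centralizer : exists K : nat -> 'End(g), K 0%N = \1%VF /\
  forall x, x \in A -> forall n, lie h (K n.+1 x) + lie u (K n x) = 0.
Proof.
have [Z [beta [K [K0 betaA Kode Bode]]]] := formal_flow.
exists K; split => // x xA.
pose Kx y j := K j y.
have D0 y : y \in A -> forall n, conv (Kx y) (Kx x) n = 0.
  move=> yA; apply: (@ode_unique _ _ Z) => [n|].
    rewrite conv_leibniz conv_jacobi; congr (_ + _); apply: eq_bigr => i _.
      by rewrite Kode.
    by rewrite Kode.
  by rewrite /conv big_ord1 /Kx subn0 K0 !id_lfunE A_abelian.
have C0 : forall n, conv B (Kx x) n = 0.
  apply: (@ode_unique _ _ Z) => [n|]; last first.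
    by rewrite /conv big_ord1 /Kx subn0 K0 !id_lfunE A_cent.
  rewrite conv_leibniz conv_jacobi.
  have -> : conv B (dseq (Kx x)) n = conv B (conv Z (Kx x)) n.
    by apply: eq_bigr => i _; rewrite Kode.
  congr (_ + _); transitivity (conv (conv Z B) (Kx x) n +
     \sum_(k < n.+1) \sum_(i < k.+1) lie (K (k - i)%N (beta i)) (K (n - k)%N x)).
    rewrite -big_split; apply: eq_bigr => k _ /=.
    by rewrite Bode lieDl; congr (_ + _); rewrite lie_suml.
  rewrite (triangle_assoc n (fun i j l => lie (K j (beta i)) (K l x))).
  rewrite big1 ?addr0 // => i _.
  exact: (D0 (beta i) (betaA i) (n - i)%N).
move=> n; have := C0 n.+1; rewrite /conv !big_ord_recl /= big1 ?addr0.
  by rewrite /Kx subn0 subSS subn0.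
by move=> i _; rewrite /B nth_default ?lie0l // /bump.
Qed.

End FormalConjugation.

(** * Abelian subspaces and centralizers in a compact Lie algebra *)

Lemma min_dim_spec (R : fieldType) (g : lieAlgType R) (M : {vspace g})
    (F : g -> {vspace g}) :
  (exists2 y, y \in M & \dim (F y) = min_dim M F) /\
  (forall y, y \in M -> (min_dim M F <= \dim (F y))%N).
Proof.
rewrite /min_dim; case: ex_minnP => d /asboolP dP dmin; split=> // y yM.
by apply: dmin; apply/asboolP; exists y.
Qed.

Lemma lie_rank_spec (R : fieldType) (g : lieAlgType R) (U : {vspace g}) :
  (exists T : {vspace g}, [/\ (T <= U)%VS, lie_abelian T & \dim T = lie_rank U])
  /\ (forall T : {vspace g}, (T <= U)%VS -> lie_abelian T ->
        (\dim T <= lie_rank U)%N).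
Proof.
rewrite /lie_rank; case: ex_maxnP => d /asboolP dP dmax; split=> // T sTU abT.
by apply: dmax; apply/asboolP; exists T.
Qed.

Section RankBound.
Variables (R : realType) (g : lieAlgType R) (n : nat).
Variable chi : {linear g -> 'M[R]_n}.
Hypothesis chi_rep : is_representation chi.
Hypothesis chi_neg : forall x : g, x != 0 -> trace_form chi x x < 0.
Implicit Types (x y z u w h : g) (U A : {vspace g}).

Local Notation ip := (scalar_product chi).
Local Notation oproj := (oproj chi).

(** The operator ad h is skew, so its image is the orthogonal complement of its
    kernel. *)
Lemma limg_ad_ortho h : limg (ad h) = ortho_compl chi (centralizer fullv h).
Proof.
have sub : (limg (ad h) <= ortho_compl chi (centralizer fullv h))%VS.
  apply/subvP => _ /memv_imgP[v _ ->]; apply/ortho_complP => x.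
  rewrite centralizerP => /andP[_ /eqP hx].
  by rewrite ipC adE ip_skew // hx linear0 oppr0.
apply/eqP; rewrite eqEdim sub /= -(leq_add2l (\dim (centralizer fullv h))).
rewrite centralizer_dim -dimv_disjoint_sum ?ortho_cap //.
exact: dimvS (subvf _).
Qed.

(** Suppose that the centralizer W of h + u is smaller than A, the centralizer
    of h. The polynomial P(t), the determinant of ad (h + t u) plus the
    projection on W, does not vanish at t = 1. But up to order m the formal
    centralizer K provides curves issuing from the elements of A that
    ad (h + t u) kills; the endomorphism then sends them into W, which is too
    small, and P is divisible by every power of t. *)
Lemma abelian_centralizer_dim_le h u :
  lie_abelian (centralizer fullv h) ->
  (\dim (centralizer fullv h) <= \dim (centralizer fullv (h + u)%R))%N.
Proof.
set A := centralizer fullv h => abA; rewrite leqNgt; apply/negP => ltd.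
have hA x : x \in A -> lie h x = 0 by rewrite centralizerP => /andP[_ /eqP].
have Asplit v : exists p : g * g, p.2 \in A /\ v = lie p.1 h + p.2.
  have := oprojC_in chi_neg A v; rewrite -limg_ad_ortho => /memv_imgP[z _ vz].
  exists (- z, oproj A v); split; first exact: oproj_in.
  by rewrite lieNl -lieC -adE -vz subrK.
have [K [K0 Kh]] := formal_centralizer u abA hA Asplit.
pose W := centralizer fullv (h + u).
pose C j : 'End(g) := if j is 0%N then (ad h + oproj W)%R else ad u.
pose P := det_curve C 2.
have CE t : \sum_(j < 2) t ^+ j *: C j = (ad h + oproj W + t *: ad u)%R.
  by rewrite !big_ord_recl big_ord0 /= addr0 expr0 expr1 scale1r.
have P1 : P.[1] != 0.
  rewrite det_curveE CE lfun_det_neq0 -subv0; apply/subvP => v.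
  rewrite memv_ker !add_lfunE scale_lfunE scale1r !adE addrAC -lieDl => /eqP wv.
  have wvW : lie (h + u) v \in ortho_compl chi W.
    by rewrite -limg_ad_ortho -adE memv_img ?memvf.
  have pv : oproj W v \in ortho_compl chi W.
    by move/eqP: wv; rewrite addrC addr_eq0 => /eqP ->; rewrite memvN.
  have pv0 : oproj W v = 0.
    apply/eqP; rewrite -memv0 -(ortho_cap chi_neg W) memv_cap pv andbT.
    exact: oproj_in.
  have : v \in W by rewrite centralizerP memvf -[lie _ _]addr0 -{1}pv0 wv eqxx.
  by move/(oproj_id chi_neg) <-; rewrite pv0 mem0v.
suff P0 : P = 0 by rewrite P0 horner0 eqxx in P1.
apply: poly_Xn_dvd0 => -[|m]; first by rewrite expr0 dvd1p.
(* D is the truncation of K on A, extended by the identity on the complement of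
   A; its determinant is 1 at t = 0. The composite of D and C differs by a
   multiple of 'X^(m.+1) from a curve T which maps A into W and is therefore
   singular. *)
pose D j : 'End(g) := if j is 0%N then \1%VF else (K j \o oproj A)%VF.
pose E : 'End(g) := (ad u \o (K m \o oproj A))%VF.
pose e := vbasis {:g}; have e_basis : basis_of {:g} e by exact: vbasisP.
pose T := mxcurve D m.+1 *m mxcurve C 2
  + - 'X^(m.+1) *: map_mx polyC (mxof e e E).
have T0 : \det T = 0.
  apply: poly0_horner => t; rewrite -[LHS]/(horner_eval t _) -det_map_mx.
  have -> : map_mx (horner_eval t) T = mxof e e
     ((\sum_(j < 2) t ^+ j *: C j) \o (\sum_(j < m.+1) t ^+ j *: D j)
        - t ^+ m.+1 *: E)%VF.
    rewrite linearB /= (mxof_comp e e e_basis) -!mxcurveE linearZ /=.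
    rewrite map_mxD map_mxM; congr (_ + _).
    apply/matrixP => i j; rewrite !mxE /horner_eval.
    by rewrite -[LHS]/((_ * _).[t]) hornerM hornerN hornerXn hornerC mulNr.
  apply/eqP; rewrite -[_ == 0]negbK -/(lfun_det _) lfun_det_neq0.
  apply/negP => /eqP.
  set Tt := (X in lker X) => ker0.
  have : (Tt @: A <= W)%VS.
    apply/subvP => _ /memv_imgP[v vA ->].
    pose S k := \sum_(j < k.+1) t ^+ j *: K j v.
    (* All the intermediate powers of t cancel, by the choice of K. *)
    have tele k : lie h (S k) + t *: lie u (S k) = t ^+ k.+1 *: lie u (K k v).
      elim: k => [|k IH].
        by rewrite /S big_ord1 expr0 scale1r K0 id_lfunE hA // add0r expr1.
      rewrite /S big_ord_recr -/(S k) /= !linearD /= addrACA IH !linearZ /=.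
      rewrite addrA -scalerDr [lie u _ + _]addrC Kh // scaler0 add0r.
      by rewrite scalerA -exprSr.
    have SE : (\sum_(j < m.+1) t ^+ j *: D j)%R v = S m.
      rewrite sum_lfunE; apply: eq_bigr => -[[|j] ltj] _; rewrite scale_lfunE /=.
        by rewrite K0.
      by rewrite comp_lfunE oproj_id.
    rewrite add_lfunE opp_lfunE scale_lfunE !comp_lfunE SE CE oproj_id // adE.
    rewrite !add_lfunE scale_lfunE !adE [X in X - _]addrAC tele addrAC subrr add0r.
    exact: oproj_in.
  move/dimvS; rewrite limg_dim_eq; last by rewrite ker0 capv0.
  by rewrite leqNgt ltd.
have := det_perturb_dvd (mxcurve D m.+1 *m mxcurve C 2)
   (map_mx polyC (mxof e e E)) (- 'X^(m.+1)).
rewrite -/T T0 sub0r dvdpNr dvdpNl det_mulmx Gauss_dvdpr //.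
rewrite coprimep_expl // coprimep_sym -['X]subr0 coprimep_XsubC /root.
rewrite -/(det_curve _ _) det_curveE big_ord_recl big1 => [|j _]; last first.
  by rewrite expr0n scale0r.
by rewrite addr0 expr0 scale1r /= lfun_det1 oner_eq0.
Qed.

(** An abelian subspace T of the largest dimension is the centralizer of a
    generic element h of T: by minimality along the pencils h + t b with b in T,
    the centralizer of h commutes with T, and so is contained in T by
    maximality. *)
Lemma abelian_centralizer_max : exists h,
  lie_abelian (centralizer fullv h) /\
  (forall A, lie_abelian A -> (\dim A <= \dim (centralizer fullv h))%N).
Proof.
have [[T [_ abT dT]] maxT] := lie_rank_spec (fullv : {vspace g}).
have [[h hT dh] minh] := min_dim_spec T (centralizer fullv).
have hcomm k b : k \in centralizer fullv h -> b \in T -> lie b k = 0.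
  move=> kh bT; apply: (ip_eq0 chi_neg); apply: (first_order chi_rep kh).
    rewrite centralizerP memvf /= lie_leibniz (abT h b hT bT) lie0l add0r.
    by move: kh; rewrite centralizerP => /andP[_ /eqP ->]; rewrite linear0.
  by move=> t; rewrite dh minh // rpredD // rpredZ.
exists h; suff -> : centralizer fullv h = T.
  by split=> // A abA; rewrite dT maxT ?subvf.
apply/eqP; rewrite eq_sym eqEsubv; apply/andP; split; apply/subvP => k kT.
  by rewrite centralizerP memvf abT //=.
have abTk : lie_abelian (T + <[k]>)%VS.
  move=> x y /memv_addP[x1 x1T [_ /vlineP[c ->] ->]].
  move=> /memv_addP[y1 y1T [_ /vlineP[d ->] ->]].
  rewrite lieDl !linearD /= !lieZl !linearZ /= (abT x1 y1) //.
  rewrite liexx (hcomm k x1) // lieC (hcomm k y1) //.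
  by rewrite oppr0 !scaler0 !addr0.
have /eqP -> : T == (T + <[k]>)%VS.
  by rewrite eqEdim addvSl dT maxT ?subvf.
exact: (subvP (addvSr T <[k]>%VS)) (memv_line k).
Qed.

(** The pencil from h to w, where the centralizer of h is abelian of the largest
    dimension, shows that w has at least as large a centralizer. *)
Lemma abelian_dim_le_centralizer A w :
  lie_abelian A -> (\dim A <= \dim (centralizer fullv w))%N.
Proof.
have [h [abh maxh]] := abelian_centralizer_max => /maxh leA.
apply: (leq_trans leA); have := abelian_centralizer_dim_le (w - h) abh.
by rewrite addrC subrK.
Qed.

End RankBound.

(** * Determinants along a quadratic curve *)

Section MinimalOrder.
Variables (F : numFieldType) (V : vectType F) (m : nat).
Variables (C : 'M[F]_m) (M : {linear V -> 'M[F]_m}) (S : {vspace V}).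

Let p w : {poly F} := \det (map_mx polyC C + 'X *: map_mx polyC (M w)).

Let pE w t : (p w).[t] = \det (C + t *: M w).
Proof.
rewrite -[LHS]/(horner_eval t _) -det_map_mx; congr (\det _).
apply/matrixP => i j; rewrite !mxE -[LHS]/((_ + _).[t]).
by rewrite hornerD hornerM hornerX !hornerC.
Qed.

(** Let N be the lowest order at t = 0 of det (C + t M w) for w in S; it is
    finite because of y, at which t = 1 is not a root. If w attains it then,
    whatever e in S is, det (C + t M (w + t e)) also has order N: in
    det (C + t M (w + s e)) the coefficients of index less than N vanish for
    every s, as w + s e stays in S, and that of index N is nonzero at s = 0. *)
Lemma det_quadratic_curve y : y \in S -> \det (C + M y) != 0 ->
  exists2 w, w \in S & forall e, e \in S ->
    exists2 P : {poly F}, P != 0 &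
      forall t, P.[t] = \det (C + t *: M (w + t *: e)).
Proof.
move=> yS Cy.
have [|N /asboolP[w wS pwN] minN] :=
  @ex_minnP (fun j => `[< exists2 w, w \in S & (p w)`_j != 0 >]).
  exists (size (p y)).-1; apply/asboolP; exists y => //.
  rewrite -lead_coefE lead_coef_eq0; apply: contraNneq Cy => p0.
  by rewrite -[M y]scale1r -pE p0 horner0 eqxx.
have lowN z j : z \in S -> (j < N)%N -> (p z)`_j = 0.
  move=> zS; rewrite ltnNge => /negP jN; apply/eqP/negPn/negP => pzj.
  by apply: jN; apply: minN; apply/asboolP; exists z.
exists w => // e eS.
pose cc (A : 'M[F]_m) : 'M[{poly {poly F}}]_m := map_mx (fun c => c%:P%:P) A.
(* Here t is the outer variable and s the inner one. *)
pose G : {poly {poly F}} :=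
  \det (cc C + 'X *: (cc (M w) + 'X%:P *: cc (M e))).
have Gs s : map_poly (horner_eval s) G = p (w + s *: e).
  rewrite -det_map_mx; congr (\det _); apply/matrixP => i j.
  have -> : M (w + s *: e) = M w + s *: M e by rewrite linearD linearZ.
  rewrite !mxE !(rmorphD, rmorphM) /= map_polyX !map_polyC /=.
  by rewrite /horner_eval !hornerC hornerX mulrDr -!polyCM.
have Gj s j : (G`_j).[s] = (p (w + s *: e))`_j by rewrite -Gs coef_map.
have GX t : (G.['X]).[t] = (p (w + t *: e)).[t].
  by rewrite -Gs -[LHS]/(horner_eval t _) -horner_map /= /horner_eval hornerX.
exists G.['X]; last by move=> t; rewrite GX pE.
have take0 : take_poly N G = 0.
  apply/polyP => j; rewrite coef_take_poly coef0; case: ifP => // jN.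
  by apply: poly0_horner => s; rewrite Gj lowN // rpredD // rpredZ.
rewrite -(poly_take_drop N G) take0 add0r hornerM hornerXn.
rewrite mulf_neq0 ?expf_neq0 ?polyX_eq0 //.
apply: contraNneq pwN => drop0.
have <- : ((drop_poly N G).['X]).[0] = (p w)`_N; last by rewrite drop0 horner0.
rewrite -[LHS]/(horner_eval 0 _) -horner_map /= [horner_eval 0 'X]hornerX.
by rewrite horner_coef0 coef_map coef_drop_poly add0n [LHS]Gj scale0r addr0.
Qed.

End MinimalOrder.

(** * The moment map of the pair (k, m) *)

Section IsotropyPair.
Variables (R : realType) (g : lieAlgType R) (n : nat).
Variable chi : {linear g -> 'M[R]_n}.
Hypothesis chi_rep : is_representation chi.
Hypothesis chi_neg : forall x : g, x != 0 -> trace_form chi x x < 0.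
Variable a : g.
Implicit Types (x y z v c : g).

Local Notation ip := (scalar_product chi).
Local Notation oproj := (oproj chi).
Local Notation k := (centralizer fullv a).
Local Notation m := (ortho_compl chi k).

Lemma memk x : (x \in k) = (lie a x == 0).
Proof. by rewrite centralizerP memvf. Qed.

Lemma lie_kk x y : x \in k -> y \in k -> lie x y \in k.
Proof.
rewrite !memk lie_leibniz => /eqP -> /eqP ->.
by rewrite lie0l linear0 addr0.
Qed.

Lemma lie_km x y : x \in k -> y \in m -> lie x y \in m.
Proof.
move=> xk /ortho_complP ym; apply/ortho_complP => z zk.
by rewrite ipC ip_skew // ipC ym ?oppr0 // lie_kk.
Qed.

Lemma lie_mk x y : x \in m -> y \in k -> lie x y \in m.
Proof. by move=> xm yk; rewrite lieC memvN lie_km. Qed.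

Lemma lie_a_m x : lie a x \in m.
Proof. by rewrite -(limg_ad_ortho chi_rep chi_neg) -adE memv_img ?memvf. Qed.

Lemma lie_a_inj x : x \in m -> lie a x = 0 -> x = 0.
Proof.
move=> xm ax; apply/eqP; rewrite -memv0 -(ortho_cap chi_neg k) memv_cap xm.
by rewrite memk ax eqxx.
Qed.

(** The inverse of ad a on m, as an endomorphism of the whole algebra: a
    preimage under ad a, made unique by removing its component in k. *)
Definition ad_inverse : 'End(g) := ((\1 - oproj k) \o (ad a)^-1)%VF.
Local Notation J := ad_inverse.

Lemma ad_inverse_in x : J x \in m.
Proof.
by rewrite comp_lfunE add_lfunE opp_lfunE id_lfunE oprojC_in.
Qed.

Lemma lie_ad_inverse x : x \in m -> lie a (J x) = x.
Proof.
rewrite -(limg_ad_ortho chi_rep chi_neg) => /limg_lfunVK {2}<-.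
rewrite comp_lfunE add_lfunE opp_lfunE id_lfunE linearB /= adE.
have /eqP -> : lie a (oproj k ((ad a)^-1%VF x)) == 0 by rewrite -memk oproj_in.
by rewrite subr0.
Qed.

(** The operator ad a commutes with the action of k. *)
Lemma lie_a_lie x y : x \in m -> y \in k -> lie a (lie (J x) y) = lie x y.
Proof.
rewrite memk => xm /eqP ay.
by rewrite lie_leibniz lie_ad_inverse // ay linear0 addr0.
Qed.

Lemma lie_ad_inverse_eq0 x y : x \in m -> y \in k ->
  (lie (J x) y == 0) = (lie x y == 0).
Proof.
move=> xm yk; apply/eqP/eqP => [Jxy | xy].
  by rewrite -lie_a_lie // Jxy linear0.
by apply: lie_a_inj; rewrite ?lie_mk ?ad_inverse_in // lie_a_lie.
Qed.

(** Up to a constant, the moment map of the action of k on m for the symplectic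
    form <J x, y>. *)
Definition moment x : g := oproj k (lie x (J x)).

Lemma moment_in x : moment x \in k.
Proof. exact: oproj_in. Qed.

(** The form <[x, [J x, y]], z> is skew in y and z, because J is skew and
    commutes with k; so the two terms in which the Jacobi identity splits
    [[x, J x], y] contribute equally. *)
Lemma moment_form x y z : x \in m -> y \in k -> z \in k ->
  ip (lie (moment x) y) z = ip (lie x (lie (J x) y)) z *+ 2.
Proof.
move=> xm yk zk; rewrite ip_invariant // oproj_ip ?lie_kk // -ip_invariant //.
have -> : lie (lie x (J x)) y = lie x (lie (J x) y) - lie (J x) (lie x y).
  by rewrite lie_leibniz addrK.
rewrite ipDl ipNl mulr2n; congr (_ + _).
rewrite [X in - X]ip_skew // opprK [RHS]ip_skew // -(lie_a_lie xm yk).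
by rewrite ip_skew // lie_a_lie.
Qed.

(** An element of ad_a^-1 [x, k] has the form [J x, c] with c in k, and it lies
    in m(x) when [x, [J x, c]] is in m, which by [moment_form] means that c
    commutes with the moment of x. *)
Lemma Qspace_image x : x \in m ->
  (mspace m x :&: ad_inv m a (ad x @: k) =
   ad (J x) @: centralizer k (moment x))%VS.
Proof.
move=> xm.
have lie_moment y : y \in k ->
    (lie (moment x) y == 0) = (lie x (lie (J x) y) \in m).
  move=> yk; apply/eqP/ortho_complP => [xy z zk | xy].
    have := moment_form xm yk zk; rewrite xy ipC linear0 ipC => /esym/eqP.
    by rewrite mulrn_eq0 /= => /eqP.
  apply: (ortho_eq chi_neg (U := k)); rewrite ?mem0v ?lie_kk ?moment_in // => z zk.
  by rewrite moment_form // ipC xy // mul0rn ipC linear0.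
apply/vspaceP => y; apply/idP/idP.
  rewrite !memv_cap -!memv_preim !adE.
  move=> /andP[/andP[ym xym] /andP[_ /memv_imgP[c ck]]]; rewrite adE => ayc.
  have yE : y = lie (J x) c.
    apply/eqP; rewrite -subr_eq0; apply/eqP/lie_a_inj.
      by rewrite rpredB ?lie_mk ?ad_inverse_in.
    by rewrite linearB /= lie_a_lie // ayc subrr.
  rewrite yE -adE memv_img // centralizerP ck lie_moment //.
  by rewrite -yE.
case/memv_imgP => c; rewrite centralizerP => /andP[ck]; rewrite lie_moment //.
move=> xc ->; rewrite !memv_cap -!memv_preim !adE xc lie_a_lie //.
by rewrite lie_mk ?ad_inverse_in //= -adE memv_img.
Qed.

Lemma Qspace_dim x : x \in m ->
  (\dim (mspace m x :&: ad_inv m a (ad x @: k)) + \dim (centralizer k x))%N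
    = \dim (centralizer k (moment x)).
Proof.
move=> xm; rewrite Qspace_image //.
rewrite -(limg_ker_dim (ad (J x)) (centralizer k (moment x))) addnC.
congr (_ + _)%N; congr (\dim _); apply/vspaceP => y.
rewrite memv_cap memv_ker adE !centralizerP memvf /=.
case: eqP => //= ay; have yk : y \in k by rewrite memk ay.
rewrite lie_ad_inverse_eq0 //; case: (lie x y =P 0) => [xy|]; last by rewrite andbF.
rewrite andbT; symmetry; apply/eqP.
apply: (ortho_eq chi_neg (U := k)); rewrite ?mem0v ?lie_kk ?moment_in // => z zk.
rewrite moment_form //; have /eqP -> : lie (J x) y == 0.
  by rewrite lie_ad_inverse_eq0 ?xy.
by rewrite linear0 ipC linear0 mul0rn.
Qed.

(** Both terms of the differential of the moment map at x in the direction v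
    contribute equally, again because J is skew and commutes with k. *)
Lemma moment_differential x v y : x \in m -> v \in m -> y \in k ->
  ip (lie x (J v) + lie v (J x)) y = ip v (lie (J x) y) *+ 2.
Proof.
move=> xm vm yk; rewrite ipDl mulr2n [X in _ + X]ip_invariant //.
congr (_ + _); rewrite lieC ipNl ip_invariant // -(lie_a_lie xm yk).
by rewrite ipC ip_skew // opprK ipC lie_ad_inverse.
Qed.

(** The element a + t c acts separately on k, as t c, and on m, where it remains
    invertible for generic t because ad a is. *)
Lemma generic_centralizer c : c \in k ->
  exists t : R, (centralizer fullv (a + t *: c)%R <= centralizer k c)%VS.
Proof.
move=> ck; have [P P0 Ple] := rank_lower_semicont m (ad a) (ad c).
have [|t] := @poly_neq0_horner _ ('X * P); first by rewrite mulf_neq0 ?polyX_eq0.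
rewrite hornerM hornerX mulf_eq0 negb_or => /andP[t0 /Ple {}Ple]; exists t.
have inj : (m :&: lker (ad a + t *: ad c)%R = 0)%VS.
  apply/eqP; rewrite -dimv_eq0 -leqn0.
  rewrite -(leq_add2r (\dim ((ad a + t *: ad c)%R @: m))) limg_ker_dim add0n.
  rewrite -(limg_ker_dim (ad a) m) [(m :&: lker (ad a))%VS](_ : _ = 0%VS).
    by rewrite dimv0.
  apply/eqP; rewrite -subv0; apply/subvP => y; rewrite memv_cap memv_ker adE.
  by case/andP=> ym /eqP /(lie_a_inj ym) ->; rewrite mem0v.
apply/subvP => y; rewrite centralizerP => /andP[_].
set b := a + t *: c; pose yk := oproj k y; pose ym := y - yk.
have yE : y = yk + ym by rewrite addrC subrK.
have ykk : yk \in k by exact: oproj_in.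
have ymm : ym \in m by exact: oprojC_in.
have byk : lie b yk = t *: lie c yk.
  by move: ykk; rewrite memk lieDl lieZl => /eqP ->; rewrite add0r.
have bym : lie b ym \in m.
  by rewrite lieDl rpredD ?lie_a_m // lie_km // rpredZ.
rewrite {1}yE linearD /= byk addrC addr_eq0 => /eqP bE.
have ym0 : ym = 0.
  apply/eqP; rewrite -memv0 -inj memv_cap ymm memv_ker.
  rewrite add_lfunE scale_lfunE !adE -lieZl -lieDl -/b.
  rewrite -memv0 -(ortho_cap chi_neg k) memv_cap bym andbT bE memvN.
  by rewrite rpredZ // lie_kk.
rewrite centralizerP yE ym0 addr0 ykk /=.
move: bE; rewrite ym0 linear0 => /esym/eqP; rewrite oppr_eq0 scaler_eq0.
by rewrite (negPf t0).
Qed.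

(** By [first_order] the brackets of the centralizer of x are orthogonal to m,
    so they lie in k and centralize x: they are central. But a bracket of
    elements of g is orthogonal to the center. *)
Lemma centralizer_in_m_abelian x : x \in m ->
  (forall y, y \in m ->
     (\dim (centralizer fullv x) <= \dim (centralizer fullv y))%N) ->
  centralizer k x = lie_center g -> lie_abelian (centralizer fullv x).
Proof.
move=> xm minx kx y z yx zx; apply: (ip_eq0 chi_neg).
suff /lie_centerP wz : lie y z \in lie_center g.
  by rewrite ip_invariant // lieC wz oppr0 linear0.
rewrite -kx centralizerP; apply/andP; split; last first.
  move: yx zx; rewrite !centralizerP lie_leibniz => /andP[_ /eqP ->].
  by move=> /andP[_ /eqP ->]; rewrite lie0l linear0 addr0.
set w := lie y z; have wm v : v \in m -> ip v w = 0.
  move=> vm; rewrite -ip_invariant //; apply: (first_order chi_rep yx zx) => t.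
  by rewrite minx // rpredD // rpredZ.
suff /eqP : w - oproj k w = 0 by rewrite subr_eq0 => /eqP ->; exact: oproj_in.
have wom := oprojC_in chi_neg k w.
apply: (ip_eq0 chi_neg); rewrite linearB /= wm // sub0r ipC.
by move/ortho_complP: wom => ->; rewrite ?oppr0 // oproj_in.
Qed.

(** The bounds come from [abelian_dim_le_centralizer], transported to k by
    [generic_centralizer]. That k has an abelian subspace of the dimension of
    the centralizer of x follows from [first_order] at an element c of k with
    the smallest centralizer in k: that centralizer is abelian. *)
Lemma regular_in_m x : x \in m ->
    (forall y, y \in m ->
      (\dim (centralizer fullv x) <= \dim (centralizer fullv y))%N) ->
    centralizer k x = lie_center g ->
  \dim (centralizer fullv x) = lie_rank k /\
  (forall c, c \in k -> (lie_rank k <= \dim (centralizer k c))%N).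
Proof.
move=> xm minx kx; have abx := centralizer_in_m_abelian xm minx kx.
have rank_le (A : {vspace g}) c : lie_abelian A -> c \in k ->
    (\dim A <= \dim (centralizer k c))%N.
  move=> abA /generic_centralizer[t /dimvS]; apply: leq_trans.
  exact: (abelian_dim_le_centralizer chi_rep chi_neg).
have [[T [Tk abT dT]] maxT] := lie_rank_spec k.
suff rE : \dim (centralizer fullv x) = lie_rank k.
  by split=> // c ck; rewrite -dT rank_le.
apply/eqP; rewrite eqn_leq; apply/andP; split; last first.
  by rewrite -dT (abelian_dim_le_centralizer chi_rep chi_neg).
have [[c ck dc] minc] := min_dim_spec k (centralizer k).
apply: leq_trans (rank_le _ _ abx ck) _; apply: maxT; first exact: capvSl.
move=> y z yc zc; apply: (ip_eq0 chi_neg).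
have [yk zk] : y \in k /\ z \in k.
  by move: yc zc; rewrite !centralizerP memvf => /andP[-> _] /andP[-> _].
rewrite -ip_invariant //; apply: (first_order chi_rep yc zc) => t.
by rewrite dc minc // rpredD ?rpredZ ?lie_kk.
Qed.

End IsotropyPair.

(** * The involution *)

Section InvolutiveAutomorphism.
Variables (R : realType) (g : lieAlgType R) (n : nat).
Variable chi : {linear g -> 'M[R]_n}.
Hypothesis chi_rep : is_representation chi.
Hypothesis chi_neg : forall x : g, x != 0 -> trace_form chi x x < 0.
Variable sigma : 'End(g).
Hypothesis sigma_lie : forall x y, sigma (lie x y) = lie (sigma x) (sigma y).
Hypothesis sigma_inv : involutive sigma.
Hypothesis sigma_isom : forall x y : g,
  scalar_product chi (sigma x) (sigma y) = scalar_product chi x y.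
Variable a : g.
Hypothesis sigma_a : sigma a = - a.
Implicit Types (x y z v w c : g).

Local Notation ip := (scalar_product chi).
Local Notation oproj := (oproj chi).
Local Notation k := (centralizer fullv a).
Local Notation m := (ortho_compl chi k).
Local Notation J := (ad_inverse chi a).

Lemma plus_spaceP x : (x \in plus_space sigma) = (sigma x == x).
Proof. by rewrite memv_ker add_lfunE opp_lfunE id_lfunE subr_eq0. Qed.

Lemma minus_spaceP x : (x \in minus_space sigma) = (sigma x == - x).
Proof. by rewrite memv_ker add_lfunE id_lfunE addr_eq0. Qed.

Lemma sigma_k x : x \in k -> sigma x \in k.
Proof.
rewrite !memk => /eqP ax; apply/eqP/oppr_inj.
by rewrite oppr0 -lieNl -sigma_a -sigma_lie ax linear0.
Qed.

Lemma sigma_m x : x \in m -> sigma x \in m.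
Proof.
move=> /ortho_complP xm; apply/ortho_complP => y yk.
by rewrite -sigma_isom sigma_inv xm ?sigma_k.
Qed.

Lemma sigma_oproj x : sigma (oproj k x) = oproj k (sigma x).
Proof.
apply: (ortho_eq chi_neg (U := k)); rewrite ?sigma_k ?oproj_in // => y yk.
by rewrite oproj_ip // -sigma_isom sigma_inv oproj_ip ?sigma_k // -sigma_isom
  sigma_inv.
Qed.

Lemma sigma_ad_inverse x : x \in m -> sigma x = x -> sigma (J x) = - J x.
Proof.
move=> xm sx; apply/eqP; rewrite -addr_eq0; apply/eqP.
have Jm := ad_inverse_in chi_neg a x.
apply: (lie_a_inj chi_neg); first by apply: rpredD; [exact: sigma_m|exact: Jm].
have aJ : lie a (J x) = x by exact: lie_ad_inverse.
have aE y : lie a y = - lie (sigma a) y by rewrite sigma_a lieNl opprK.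
by rewrite linearD /= aJ aE -sigma_lie aJ sx addNr.
Qed.

Lemma moment_minus x : x \in m -> sigma x = x ->
  sigma (moment chi a x) = - moment chi a x.
Proof.
move=> xm sx; rewrite sigma_oproj sigma_lie sx sigma_ad_inverse //.
by rewrite !linearN.
Qed.

(** The differential at x of the moment map; see [moment_diffE]. *)
Definition moment_diff x : 'End(g) := (oproj k \o (ad x \o J - ad (J x)))%VF.

Lemma moment_diffE x v : moment_diff x v = oproj k (lie x (J v) + lie v (J x)).
Proof.
by rewrite comp_lfunE add_lfunE opp_lfunE comp_lfunE !adE -lieC.
Qed.

Lemma moment_curve x v t : moment chi a (x + t *: v) =
  moment chi a x + t *: (moment_diff x v + t *: moment chi a v).
Proof.
have E : lie (x + t *: v) (J (x + t *: v)) = lie x (J x)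
    + t *: (lie x (J v) + lie v (J x) + t *: lie v (J v)).
  by rewrite lieDl lieZl !linearD /= !linearZ /= -!addrA.
rewrite /moment moment_diffE E linearD /= linearZ /=.
by rewrite [X in t *: X]linearD linearZ.
Qed.

(** An element d of k' orthogonal to the image of the fixed part of m under the
    differential is orthogonal to [moment_diff x v] for v = [J x, d], which is
    fixed by sigma. By [moment_differential] this says that v has norm 0, so d
    commutes with J x and hence with x. *)
Lemma moment_submersion x w : x \in m -> sigma x = x ->
    w \in k -> sigma w = - w ->
  exists v, [/\ v \in m, sigma v = v & w - moment_diff x v \in centralizer k x].
Proof.
move=> xm sx wk sw.
pose mt := (m :&: plus_space sigma)%VS; pose S := (moment_diff x @: mt)%VS.
have /memv_imgP[v] : oproj S w \in S by exact: oproj_in.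
rewrite memv_cap plus_spaceP => /andP[vm /eqP sv] Sw; exists v; split=> //.
rewrite -Sw; set d := w - oproj S w.
have dk : d \in k by rewrite rpredB // Sw moment_diffE oproj_in.
have Jm := ad_inverse_in chi_neg a.
have sS : sigma (moment_diff x v) = - moment_diff x v.
  rewrite moment_diffE sigma_oproj -linearN opprD; congr (oproj k _).
  by rewrite linearD /= !sigma_lie sx sv !sigma_ad_inverse // !linearN.
have sd : sigma d = - d by rewrite /d Sw linearB /= sw sS opprB opprK addrC.
have sJ : sigma (lie (J x) d) = lie (J x) d.
  by rewrite sigma_lie sd sigma_ad_inverse // lieNl linearN opprK.
have Jdm : lie (J x) d \in m by rewrite (lie_mk chi_rep) // Jm.
rewrite centralizerP dk -(lie_ad_inverse_eq0 chi_rep chi_neg xm dk) /=.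
apply/eqP/(ip_eq0 chi_neg)/eqP.
have /ortho_complP/(_ (moment_diff x (lie (J x) d))) : d \in ortho_compl chi S.
  exact: oprojC_in.
rewrite memv_img => [|]; last by rewrite memv_cap plus_spaceP sJ Jdm eqxx.
rewrite moment_diffE oproj_ip // moment_differential // => /(_ isT) /eqP.
by rewrite mulrn_eq0.
Qed.

End InvolutiveAutomorphism.

(** * Regular elements of k' and points of Q *)

Section Regularity.
Variables (R : realType) (g : lieAlgType R).
Implicit Types (U K : {vspace g}).

(** An element z has on U a centralizer no larger than that of y as soon as the
    determinant of the rank test of ad z against ad y is nonzero. This
    determinant is nonzero at z = y, so [det_quadratic_curve] applies, with base
    point c. *)
Lemma regular_quadratic_curve U K (y c : g) : y \in K -> c \in K ->
  exists2 w, w \in K & forall e, e \in K ->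
    exists2 P : {poly R}, P != 0 & forall t, P.[t] != 0 ->
      (\dim (centralizer U (c + t *: (w + t *: e))%R)
        <= \dim (centralizer U y))%N.
Proof.
move=> yK cK; pose b := vbasis {:g}.
have b_basis : basis_of {:g} b by exact: vbasisP.
pose f z : 'End(g) := (ad z \o projv U)%VF.
pose M z := mxof b b (f z \o (f y)^-1)%VF.
have M_lin : linear M.
  move=> s z z'; rewrite /M -linearP; congr (mxof b b _); apply/lfunP => v.
  by rewrite !(comp_lfunE, add_lfunE, scale_lfunE) linearP add_lfunE scale_lfunE.
pose isM := GRing.isLinear.Build R g _ _ M M_lin.
pose Ml : {linear g -> 'M[R]_(\dim {:g})} := HB.pack M isM.
pose C := mxof b b (rank_test (f y) (f c)).
have CM z : \det (C + M z) = lfun_det (rank_test (f y) (f (c + z))).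
  rewrite /C /M -linearD /= /rank_test -addrA -comp_lfunDl; congr (lfun_det _).
  congr (_ + (_ \o _)%VF); apply/lfunP => v.
  by rewrite !(comp_lfunE, add_lfunE) linearD add_lfunE.
have [||w wK We] := @det_quadratic_curve _ _ _ C Ml K (y - c).
- by rewrite rpredB.
- by rewrite CM addrC subrK rank_test_id lfun_det1 oner_neq0.
exists w => // e /We[P P0 PE]; exists P => // t; rewrite PE -linearZ CM.
by move/rank_test_dim; rewrite !limg_projr leq_centralizer_dim.
Qed.

End Regularity.
Theorem proposition2p10 (R : realType) (g : lieAlgType R)
    (n : nat) (chi : {linear g -> 'M[R]_n})
    (chi_rep : is_representation chi) (chi_faithful : injective chi)
    (chi_neg : forall x : g, x != 0 -> trace_form chi x x < 0)
    (sigma : 'End(g)) (sigma_aut : lie_automorphism sigma)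
    (sigma_inv : involutive sigma)
    (sigma_isom : forall x y : g,
       scalar_product chi (sigma x) (sigma y) = scalar_product chi x y)
    (a : g) (ha : a \in minus_space sigma) :
  let gt : {vspace g} := plus_space sigma in
  let k : {vspace g} := centralizer fullv a in
  let m : {vspace g} := ortho_compl chi k in
  let kt : {vspace g} := (k :&: gt)%VS in
  let k' : {vspace g} := ((\1 - sigma)%VF @: k)%VS in
  let mt : {vspace g} := (m :&: gt)%VS in
  Rset fullv k m `&` [set` mt] !=set0 ->
  forall x0 : g, (Rset fullv k m `&` Rset gt kt mt) x0 ->
  centralizer k x0 = lie_center g ->
  (Qset a fullv k m `&` [set` mt] !=set0 <->
   exists2 y : g, y \in k' & regular_in k y).
Proof.
move=> gt k m kt k' mt _ x0 [[x0m qx0 px0] [x0mt _ _]] kx0.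
have [_ sigma_lie] := sigma_aut.
have sa : sigma a = - a by apply/eqP; rewrite -minus_spaceP.
have k'E : k' = (k :&: minus_space sigma)%VS by exact: one_sub_sigmaE.
have minq y : y \in m -> (qdim fullv m <= \dim (centralizer fullv y))%N.
  by move=> ym; apply: (min_dim_spec m (centralizer fullv)).2.
have minp y : y \in m -> (pdim k m <= \dim (centralizer k y))%N.
  by move=> ym; apply: (min_dim_spec m (centralizer k)).2.
have [|rkE rk_le] := @regular_in_m _ _ _ _ chi_rep chi_neg a x0 x0m _ kx0.
  by move=> y ym; rewrite qx0 minq.
have pq : (pdim k m <= qdim fullv m)%N.
  by rewrite -px0 -qx0 dimvS // capvS ?subvf.
have mtE x : (x \in mt) = (x \in m) && (sigma x == x).
  by rewrite -plus_spaceP; exact: memv_cap.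
have mtP x : x \in mt -> x \in m /\ sigma x = x.
  by rewrite mtE => /andP[xm /eqP].
have k'P x : (x \in k') = (x \in k) && (sigma x == - x).
  by rewrite -minus_spaceP k'E; exact: memv_cap.
have mom_k' x : x \in mt -> moment chi a x \in k'.
  move=> /mtP[xm sx]; rewrite k'P moment_in.
  apply/eqP.
  exact: (moment_minus chi_rep chi_neg sigma_lie sigma_inv sigma_isom sa xm sx).
split=> [[x [[[xm qx px] dQ] /= xmt]] | [y yk' [yk ry]]].
  exists (moment chi a x); first exact: mom_k'.
  split; first exact: moment_in.
  rewrite -(Qspace_dim chi_rep chi_neg xm) dQ px /rdim subnK //.
  by rewrite -qx0 rkE.
(* The direction w is the generic one; v is chosen so that x0 + t v has moment
   c + t (w + t e) modulo the center, where c and e are the moments of x0 and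
   v. *)
have [w wk' Pw] := regular_quadratic_curve k yk' (mom_k' x0 x0mt).
have [_ sx0] := mtP x0 x0mt.
have [v [vm sv dv]] : exists v, [/\ v \in m, sigma v = v &
    w - moment_diff chi a x0 v \in centralizer k x0].
  move: wk'; rewrite k'P => /andP[wk /eqP sw].
  exact: (moment_submersion chi_rep chi_neg sigma_lie sigma_inv sigma_isom sa
    x0m sx0 wk sw).
have vmt : v \in mt by rewrite mtE vm sv eqxx.
have [P P0 Py] := Pw _ (mom_k' v vmt).
have [P1 P10 P1x] := rank_lower_semicont fullv (ad x0) (ad v).
have [P2 P20 P2x] := rank_lower_semicont k (ad x0) (ad v).
have [|t] := @poly_neq0_horner _ (P * (P1 * P2)); first by rewrite !mulf_neq0.
rewrite !hornerM !mulf_eq0 !negb_or => /andP[/Py Pt /andP[/P1x P1t /P2x P2t]].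
pose x := x0 + t *: v.
have adx : ad x = ad x0 + t *: ad v by rewrite /x linearD linearZ.
have xmt : x \in mt by rewrite rpredD ?rpredZ.
have [xm sx] := mtP x xmt.
have qx : \dim (centralizer fullv x) = qdim fullv m.
  apply/eqP; rewrite eqn_leq minq // andbT -qx0.
  by rewrite leq_centralizer_dim adx.
have px : \dim (centralizer k x) = pdim k m.
  apply/eqP; rewrite eqn_leq minp // andbT -px0.
  by rewrite leq_centralizer_dim adx.
exists x; split=> //; split=> //.
apply/eqP; rewrite -(eqn_add2r (\dim (centralizer k x))) Qspace_dim // px.
rewrite /rdim subnK // -qx0 rkE eqn_leq rk_le ?moment_in // andbT -ry.
suff -> : centralizer k (moment chi a x) = centralizer k
    (moment chi a x0 + t *: (w + t *: moment chi a v))%R by [].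
apply/vspaceP => z; rewrite !centralizerP /x moment_curve; congr (_ && (_ == 0)).
have /lie_centerP zc : w - moment_diff chi a x0 v \in lie_center g by rewrite -kx0.
apply/esym/eqP; rewrite -subr_eq0 -lieNl -lieDl opprD addrACA subrr add0r.
by rewrite -scalerBr opprD addrACA subrr addr0 lieZl zc scaler0.
Qed.
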